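(* Let $p\ge 3$ be an odd integer and let $P=A_0A_1\cdots A_{p-1}$ be a $p$-gon of density $q$ inscribed in and circumscribed about a pair of homothetic ellipses with common center $O$ (inscribed in one and circumscribed about the other), whose inellipse (the one about which $P$ is circumscribed) has semi-axes of lengths $\alpha$ and $\beta$. Then, with indices modulo $p$, $$\sum_{k=0}^{p-1}|A_kA_{k+1}|^2=2p(\alpha^2+\beta^2)\tan^2\!\left(\frac{q\pi}{p}\right).$$
   Context: All objects lie in the Euclidean plane. A $p$-gon $A_0A_1\cdots A_{p-1}$ is a cyclically ordered sequence of $p$ distinct points (vertices), with sides $\overline{A_kA_{k+1}}$ (indices modulo $p$); it may be self-crossing. It is inscribed in an ellipse if all its vertices lie on the ellipse, and circumscribed about an ellipse if every line $A_kA_{k+1}$ is tangent to the ellipse. Two ellipses with common center $O$ are homothetic if one is the image of the other under a homothety centered at $O$; circles are allowed as ellipses. Density: for coprime positive integers $p,q$ with $1\le q\le\lfloor p/2\rfloor$, the regular polygon $\{p/q\}$ has vertices obtained by successive rotations of a vertex about the center through the angle $2q\pi/p$. A $p$-gon has density $q$ if its vertices are connected according to the same cyclic ordering as $\{p/q\}$: that is, if $V_0,V_1,\dots,V_{p-1}$ are its vertices listed in cyclic order around the outer ellipse (in a suitable one of the two directions, starting at $V_0=A_0$), then $A_k=V_{qk \bmod p}$ for all $k$. *)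

(* Defs.v *)
From mathcomp Require Import all_boot all_order all_algebra.
From mathcomp Require Import all_classical all_reals all_analysis.

Set Implicit Arguments.
Unset Strict Implicit.
Unset Printing Implicit Defensive.

Import Order.TTheory GRing.Theory Num.Theory.
Local Open Scope classical_set_scope.
Local Open Scope ring_scope.

(* The norm that the library puts on 'rV[R]_2 is the sup norm, hence the
   Euclidean structure of the plane is introduced here. *)
Definition dot (R : realType) (u v : 'rV[R]_2) : R := \sum_i u 0 i * v 0 i.

Definition euclid_dist (R : realType) (X Y : 'rV[R]_2) : R :=
  Num.sqrt (dot (Y - X) (Y - X)).

(* The two semi-axis lengths are not ordered, and circles are allowed. *)
Record ellipse (R : realType) := Ellipse {
  center : 'rV[R]_2;
  axis1 : 'rV[R]_2;
  axis2 : 'rV[R]_2;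
  semiaxis1 : R;
  semiaxis2 : R;
  axis1_unit : dot axis1 axis1 = 1;
  axis2_unit : dot axis2 axis2 = 1;
  axes_orthogonal : dot axis1 axis2 = 0;
  semiaxis1_gt0 : 0 < semiaxis1;
  semiaxis2_gt0 : 0 < semiaxis2
}.

Definition ellipse_point (R : realType) (E : ellipse R) (t : R) : 'rV[R]_2 :=
  center E + (semiaxis1 E * cos t) *: axis1 E
           + (semiaxis2 E * sin t) *: axis2 E.

Definition locus (R : realType) (E : ellipse R) : set 'rV[R]_2 :=
  range (ellipse_point E).

Definition homothety (R : realType) (O : 'rV[R]_2) (k : R) (X : 'rV[R]_2) :
    'rV[R]_2 :=
  O + k *: (X - O).

Definition homothetic (R : realType) (O : 'rV[R]_2) (E F : ellipse R) : Prop :=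
  [/\ center E = O, center F = O &
      exists2 k : R, k != 0 & locus F = homothety O k @` locus E].

Definition line_through (R : realType) (X Y : 'rV[R]_2) : set 'rV[R]_2 :=
  range (fun s : R => X + s *: (Y - X)).

(* A line meets an ellipse in 0, 1 or 2 points; it is tangent in the case 1. *)
Definition tangent_line (R : realType) (L : set 'rV[R]_2) (E : ellipse R) :
    Prop :=
  exists Q : 'rV[R]_2, L `&` locus E = [set Q].

(* Throughout, A is indexed by 'I_p and ordS k is k + 1 modulo p. *)
Definition polygon (R : realType) (p : nat) (A : 'I_p -> 'rV[R]_2) : Prop :=
  injective A.

Definition inscribed (R : realType) (p : nat) (A : 'I_p -> 'rV[R]_2)
    (E : ellipse R) : Prop :=
  forall k, locus E (A k).

Definition circumscribed (R : realType) (p : nat) (A : 'I_p -> 'rV[R]_2)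
    (E : ellipse R) : Prop :=
  forall k, tangent_line (line_through (A k) (A (ordS k))) E.

(* The points V 0, ..., V (p - 1) are met in this order in less than one full
   turn around E, in one of the two directions. *)
Definition cyclically_listed (R : realType) (p : nat) (E : ellipse R)
    (V : 'I_p -> 'rV[R]_2) : Prop :=
  exists theta : 'I_p -> R,
    (forall j, V j = ellipse_point E (theta j)) /\
    ((forall i j : 'I_p, (i < j)%N -> theta i < theta j < theta i + 2 * pi) \/
     (forall i j : 'I_p, (i < j)%N -> theta i - 2 * pi < theta j < theta i)).

(* V 0 = A 0 is the case j = k = 0 of the last condition. *)
Definition has_density (R : realType) (p q : nat) (E : ellipse R)
    (A : 'I_p -> 'rV[R]_2) : Prop :=
  [/\ coprime p q, (1 <= q <= p./2)%N &
      exists V : 'I_p -> 'rV[R]_2,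
        cyclically_listed E V /\
        (forall j k : 'I_p, j = q * k %[mod p] -> A k = V j)].

(* Main.v *)
Require Import Defs.
From mathcomp Require Import all_boot all_order all_algebra.
From mathcomp Require Import all_classical all_reals all_analysis.
From mathcomp Require Import ring lra.

Import Order.TTheory GRing.Theory Num.Theory.
Local Open Scope classical_set_scope.
Local Open Scope ring_scope.

Set Implicit Arguments.
Unset Strict Implicit.

(** Let B be the bilinear form of the inellipse, so that the inellipse is the
    set O + x with B x x = 1.  For B the inellipse is the unit circle, and the
    homothetic outer ellipse is a concentric circle B x x = m.  Hence the
    semi-axis vectors m1, m2 of the outer ellipse are B-orthogonal of B-norm m
    ([polar_conjugate]), and two of its points at parameters s and t satisfy
    B = m cos (t - s) ([polar_arc]).

    A chord X Y of the circle B = m is symmetric under X <-> Y, so if it meets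
    the inellipse in one point only, that point is its midpoint; this gives
    m + B X Y = 2 ([tangent_polar]).  So all the angular steps of the polygon
    have the same cosine 2 / m - 1.  Two consecutive steps in (0, 2 pi) with
    equal cosines are equal or add up to a full turn; a full turn would make
    two vertices coincide, so all steps are equal ([constant_step]).  Density q
    means that the p steps make q turns in total ([lift_angle_turns]), so each
    step is 2x with x = q pi / p, and then m (cos x)^2 = 1.

    For p equal steps the squared Euclidean lengths of the chords sum to
    p (1 - cos 2x) (|m1|^2 + |m2|^2), the oscillating terms cancelling over
    complete turns ([sum_chords]).  Finally |m1|^2 + |m2|^2 = m (alpha^2 + beta^2), since
    the sum of two squared conjugate semi-diameters is an invariant
    ([conjugate_semidiameters]), and m = 1 / (cos x)^2 turns the sine into a
    tangent. *)

(** * Euclidean geometry of the plane in an orthonormal frame *)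

Lemma dotE (R : realType) (x y : 'rV[R]_2) :
  dot x y = x 0 0 * y 0 0 + x 0 1 * y 0 1.
Proof.
rewrite /dot !big_ord_recl big_ord0 addr0.
by have -> : lift ord0 ord0 = 1 :> 'I_2 by apply/val_inj.
Qed.

Lemma dot_eq0 (R : realType) (x : 'rV[R]_2) : dot x x = 0 -> x = 0.
Proof.
rewrite dotE -!expr2 => /eqP.
rewrite paddr_eq0 ?sqr_ge0 // !sqrf_eq0 => /andP[/eqP e0 /eqP e1].
apply/rowP => i; rewrite mxE; have : (i < 2)%N := ltn_ord i.
have [-> //|] := eqVneq i 0; have [-> //|] := eqVneq i 1.
by rewrite -!val_eqE /=; case: (nat_of_ord i) => [|[|]].
Qed.

Lemma dotC (R : realType) (x y : 'rV[R]_2) : dot x y = dot y x.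
Proof. by rewrite !dotE; ring. Qed.

Lemma dot_combl (R : realType) (a b : R) (x y z : 'rV[R]_2) :
  dot (a *: x + b *: y) z = a * dot x z + b * dot y z.
Proof. by rewrite !dotE !mxE; ring. Qed.

Lemma dotBl (R : realType) (x y z : 'rV[R]_2) : dot (x - y) z = dot x z - dot y z.
Proof. by rewrite !dotE !mxE; ring. Qed.

Lemma dot_combr (R : realType) (a b : R) (x y z : 'rV[R]_2) :
  dot z (a *: x + b *: y) = a * dot z x + b * dot z y.
Proof. by rewrite dotC dot_combl !(dotC z). Qed.

(** A square matrix whose rows are orthogonal of equal nonzero norm is a
    multiple of an orthogonal matrix, so its columns are too.  Up to the sign
    of the determinant e one has (r, s) = (- q, p); this is what [hs] and [hr]
    say after multiplication by m. *)
Lemma orthogonal_columns (R : realType) (m p q r s : R) :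
  m != 0 -> p ^+ 2 + q ^+ 2 = m -> r ^+ 2 + s ^+ 2 = m -> p * r + q * s = 0 ->
  [/\ p ^+ 2 + r ^+ 2 = m, q ^+ 2 + s ^+ 2 = m & p * q + r * s = 0].
Proof.
move=> m0 hpq hrs hort; pose e := p * s - q * r.
have e2 : e ^+ 2 = m ^+ 2.
  have -> : m ^+ 2 = (p ^+ 2 + q ^+ 2) * (r ^+ 2 + s ^+ 2) by rewrite hpq hrs.
  by rewrite /e -[LHS]addr0 -[X in _ + X](expr0n _ 2) -hort; ring.
have hs : m * s = p * e.
  have -> : m * s = p * e + q * (p * r + q * s) by rewrite -hpq /e; ring.
  by rewrite hort mulr0 addr0.
have hr : m * r = - (q * e).
  have -> : m * r = - (q * e) + p * (p * r + q * s) by rewrite -hpq /e; ring.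
  by rewrite hort mulr0 addr0.
have m20 : m ^+ 2 != 0 by rewrite expf_neq0.
have s2 : s ^+ 2 = p ^+ 2.
  by apply: (mulfI m20); rewrite -exprMn hs exprMn e2 mulrC.
have r2 : r ^+ 2 = q ^+ 2.
  by apply: (mulfI m20); rewrite -exprMn hr sqrrN exprMn e2 mulrC.
split; [by rewrite r2 | by rewrite s2 addrC |].
apply: (mulfI m20); rewrite mulr0.
have -> : m ^+ 2 * (p * q + r * s) = m ^+ 2 * (p * q) + (m * r) * (m * s) by ring.
by rewrite hr hs -e2; ring.
Qed.

Lemma parseval (R : realType) (E : ellipse R) (x y : 'rV[R]_2) :
  dot x y = dot x (axis1 E) * dot y (axis1 E) + dot x (axis2 E) * dot y (axis2 E).
Proof.
have := axis1_unit E; have := axis2_unit E; have := axes_orthogonal E.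
rewrite !dotE -!expr2 => h12 h2 h1.
have [h11 h22 h0] := orthogonal_columns (oner_neq0 R) h1 h2 h12.
set p := axis1 E 0 0 in h11 h0 *; set q := axis1 E 0 1 in h22 h0 *.
set r := axis2 E 0 0 in h11 h0 *; set s := axis2 E 0 1 in h22 h0 *.
transitivity ((p ^+ 2 + r ^+ 2) * (x 0 0 * y 0 0) +
  (q ^+ 2 + s ^+ 2) * (x 0 1 * y 0 1) +
  (p * q + r * s) * (x 0 0 * y 0 1 + x 0 1 * y 0 0)); last by ring.
by rewrite h11 h22 h0; ring.
Qed.

(** * The quadratic form of an ellipse *)

(** The symmetric bilinear form whose quadratic form takes the value 1 exactly
    on the ellipse translated to the origin ([locusP]). *)
Definition polar (R : realType) (E : ellipse R) (x y : 'rV[R]_2) : R :=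
  dot x (axis1 E) * dot y (axis1 E) / semiaxis1 E ^+ 2 +
  dot x (axis2 E) * dot y (axis2 E) / semiaxis2 E ^+ 2.

Lemma polarC (R : realType) (E : ellipse R) (x y : 'rV[R]_2) :
  polar E x y = polar E y x.
Proof. by rewrite /polar mulrC (mulrC (dot x (axis2 E))) (mulrC (dot x _)) mulrC. Qed.

Lemma polar_combl (R : realType) (E : ellipse R) (a b : R) (x y z : 'rV[R]_2) :
  polar E (a *: x + b *: y) z = a * polar E x z + b * polar E y z.
Proof. by rewrite /polar !dot_combl; ring. Qed.

Lemma polar_combr (R : realType) (E : ellipse R) (a b : R) (x y z : 'rV[R]_2) :
  polar E z (a *: x + b *: y) = a * polar E z x + b * polar E z y.
Proof. by rewrite polarC polar_combl !(polarC E z). Qed.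

Lemma unit_circle_param (R : realType) (x y : R) :
  x ^+ 2 + y ^+ 2 = 1 -> exists t, x = cos t /\ y = sin t.
Proof.
move=> hxy.
have hx : -1 <= x <= 1 by have y2 := sqr_ge0 y; apply/andP; split; nra.
have hsin : sin (acos x) = `|y|.
  rewrite sin_acos // -sqrtr_sqr; congr Num.sqrt.
  by rewrite -hxy; ring.
have [y0|y0] := lerP 0 y.
  by exists (acos x); rewrite acosK // hsin ger0_norm.
by exists (- acos x); rewrite cosN sinN acosK // hsin ltr0_norm // opprK.
Qed.

Lemma locusP (R : realType) (E : ellipse R) (x : 'rV[R]_2) :
  locus E (Defs.center E + x) <-> polar E x x = 1.
Proof.
have a0 := lt0r_neq0 (semiaxis1_gt0 E); have b0 := lt0r_neq0 (semiaxis2_gt0 E).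
split.
  move=> [t _]; rewrite /ellipse_point -addrA => /addrI <-.
  rewrite polar_combl !polar_combr /polar !(dotC (axis2 E) (axis1 E)).
  rewrite !axis1_unit !axis2_unit !axes_orthogonal -[RHS](cos2Dsin2 t).
  by field; rewrite a0 b0.
move=> hx.
have [t [h1 h2]] : exists t, dot x (axis1 E) / semiaxis1 E = cos t /\
    dot x (axis2 E) / semiaxis2 E = sin t.
  by apply: unit_circle_param; rewrite -hx /polar; field; rewrite a0 b0.
exists t => //; rewrite /ellipse_point -addrA; congr (_ + _).
rewrite -h1 -h2 !(mulrC (semiaxis1 E)) !(mulrC (semiaxis2 E)) !divfK //.
set y := (X in X = x).
(* y and x have the same coordinates in the frame of the axes. *)
have hort z : dot (y - x) z = 0.
  rewrite (parseval E) !dotBl /y !dot_combl (dotC (axis2 E) (axis1 E)).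
  rewrite !axis1_unit !axis2_unit !axes_orthogonal; ring.
apply/eqP; rewrite -subr_eq0; apply/eqP.
exact/dot_eq0/hort.
Qed.

(** The form takes the same value at the parameters s and 1 - s of the chord,
    so a unique point of contact must be the midpoint s = 1/2, where the value
    is (m + polar E X Y) / 2. *)
Lemma tangent_polar (R : realType) (E : ellipse R) (X Y : 'rV[R]_2) (m : R) :
  polar E X X = m -> polar E Y Y = m -> X != Y ->
  tangent_line (line_through (Defs.center E + X) (Defs.center E + Y)) E ->
  m + polar E X Y = 2.
Proof.
move=> hX hY neqXY [Q hQ].
have lineE s : Defs.center E + X + s *: (Defs.center E + Y - (Defs.center E + X)) =
    Defs.center E + ((1 - s) *: X + s *: Y).
  by apply/rowP => i; rewrite !mxE; ring.
have polarE s : polar E ((1 - s) *: X + s *: Y) ((1 - s) *: X + s *: Y) =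
    m - 2 * (s * (1 - s)) * (m - polar E X Y).
  by rewrite polar_combl !polar_combr (polarC E Y X) hX hY; ring.
have meet s : m - 2 * (s * (1 - s)) * (m - polar E X Y) = 1 ->
    Q = Defs.center E + ((1 - s) *: X + s *: Y).
  rewrite -polarE => /locusP hs.
  have : [set Q] (Defs.center E + ((1 - s) *: X + s *: Y)).
    by rewrite -hQ; split => //; exists s => //; rewrite lineE.
  by move=> /= ->.
have [s hs] : exists s, m - 2 * (s * (1 - s)) * (m - polar E X Y) = 1.
  have : [set Q] Q by [].
  by rewrite -hQ => -[[s _ <-]]; rewrite lineE => /locusP; rewrite polarE; exists s.
have hs' : m - 2 * ((1 - s) * (1 - (1 - s))) * (m - polar E X Y) = 1.
  by rewrite -[RHS]hs; ring.
have := meet _ hs'; rewrite (meet _ hs) => /addrI /eqP; rewrite -subr_eq0.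
have -> : (1 - s) *: X + s *: Y - ((1 - (1 - s)) *: X + (1 - s) *: Y) =
    (1 - 2 * s) *: (X - Y) by apply/rowP => i; rewrite !mxE; ring.
rewrite scaler_eq0 (subr_eq0 X) (negPf neqXY) orbF => /eqP h2s.
have es : s = 2^-1 by lra.
by move: hs; rewrite es => hs; lra.
Qed.

(** * Elliptic motions *)

(** With m1 and m2 a pair of conjugate semi-diameters, this is the point of
    eccentric anomaly t of a centred ellipse. *)
Definition arc (R : realType) (m1 m2 : 'rV[R]_2) (t : R) : 'rV[R]_2 :=
  cos t *: m1 + sin t *: m2.

(** Being constant along the whole curve forces the Gram matrix of (m1, m2) to
    be scalar; the parameters 0, pi/2 and pi/4 suffice to see it. *)
Lemma polar_conjugate (R : realType) (E : ellipse R) (m1 m2 : 'rV[R]_2) (m : R) :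
  (forall t, polar E (arc m1 m2 t) (arc m1 m2 t) = m) ->
  [/\ polar E m1 m1 = m, polar E m2 m2 = m & polar E m1 m2 = 0].
Proof.
move=> h.
have hx t : cos t ^+ 2 * polar E m1 m1 + sin t ^+ 2 * polar E m2 m2 +
    2 * sin t * cos t * polar E m1 m2 = m.
  by rewrite -(h t) /arc polar_combl !polar_combr (polarC E m2 m1); ring.
have h1 : polar E m1 m1 = m by rewrite -(hx 0) cos0 sin0; ring.
have h2 : polar E m2 m2 = m by rewrite -(hx (pi / 2)) cos_pihalf sin_pihalf; ring.
split=> //.
have := hx (pi / 2 / 2); rewrite h1 h2 -mulrDl cos2Dsin2 mul1r.
have -> : 2 * sin (pi / 2 / 2) * cos (pi / 2 / 2) = 1 :> R.
  rewrite -[RHS](@sin_pihalf R) [in RHS](_ : pi / 2 = pi / 2 / 2 + pi / 2 / 2);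
    last by field.
  by rewrite sinD; ring.
by lra.
Qed.

Lemma polar_arc (R : realType) (E : ellipse R) (m1 m2 : 'rV[R]_2) (m s t : R) :
  polar E m1 m1 = m -> polar E m2 m2 = m -> polar E m1 m2 = 0 ->
  polar E (arc m1 m2 s) (arc m1 m2 t) = m * cos (t - s).
Proof.
move=> h1 h2 h0; rewrite /arc polar_combl !polar_combr (polarC E m2 m1) h0 h1 h2.
by rewrite cosB; ring.
Qed.

(** The theorem of Apollonius on conjugate semi-diameters.  The coordinates of
    m1 and m2, divided by the semi-axes, are the rows of a multiple of an
    orthogonal matrix; each semi-axis thus occurs with the squared norm m of a
    column. *)
Lemma conjugate_semidiameters (R : realType) (E : ellipse R) (m1 m2 : 'rV[R]_2)
    (m : R) :
  m != 0 -> polar E m1 m1 = m -> polar E m2 m2 = m -> polar E m1 m2 = 0 ->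
  dot m1 m1 + dot m2 m2 = m * (semiaxis1 E ^+ 2 + semiaxis2 E ^+ 2).
Proof.
have a0 := lt0r_neq0 (semiaxis1_gt0 E); have b0 := lt0r_neq0 (semiaxis2_gt0 E).
move=> m0 h1 h2 h0.
pose x (w : 'rV[R]_2) := dot w (axis1 E) / semiaxis1 E.
pose y (w : 'rV[R]_2) := dot w (axis2 E) / semiaxis2 E.
have polarE v w : polar E v w = x v * x w + y v * y w.
  by rewrite /polar /x /y; field; rewrite a0 b0.
have dotE w : dot w w = (x w * semiaxis1 E) ^+ 2 + (y w * semiaxis2 E) ^+ 2.
  by rewrite (parseval E) /x /y !divfK.
rewrite !polarE -!expr2 in h1 h2 h0.
have [hx hy _] := orthogonal_columns m0 h1 h2 h0.
by rewrite !dotE mulrDr -{1}hx -hy; ring.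
Qed.

Lemma cosD2pin (R : realType) (x : R) (n : nat) : cos (x + 2 * pi * n%:R) = cos x.
Proof.
elim: n => [|n IHn]; first by rewrite mulr0 addr0.
by rewrite -[RHS]IHn -[RHS]cosD2pi; congr cos; rewrite -[n.+1]addn1 natrD; ring.
Qed.

Lemma sinD2pin (R : realType) (x : R) (n : nat) : sin (x + 2 * pi * n%:R) = sin x.
Proof.
elim: n => [|n IHn]; first by rewrite mulr0 addr0.
by rewrite -[RHS]IHn -[RHS]sinD2pi; congr sin; rewrite -[n.+1]addn1 natrD; ring.
Qed.

Lemma arcD2pin (R : realType) (m1 m2 : 'rV[R]_2) (x : R) (n : nat) :
  arc m1 m2 (x + 2 * pi * n%:R) = arc m1 m2 x.
Proof. by rewrite /arc cosD2pin sinD2pin. Qed.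

(** Each squared chord splits into its mean value (1 - cos delta) (|m1|^2 +
    |m2|^2) and an oscillating part.  Multiplied by sin delta, the oscillating
    part becomes a difference of consecutive values of sin (2 f) / 2, hence it
    telescopes to 0 over a whole number of turns. *)
Lemma sum_chords (R : realType) (m1 m2 : 'rV[R]_2) (f : nat -> R) (delta : R)
    (p q : nat) :
  dot m1 m2 = 0 -> (forall k, f k.+1 = f k + delta) -> sin delta != 0 ->
  f p = f 0%N + 2 * pi * q%:R ->
  \sum_(k < p) dot (arc m1 m2 (f k.+1) - arc m1 m2 (f k))
                   (arc m1 m2 (f k.+1) - arc m1 m2 (f k)) =
  p%:R * (1 - cos delta) * (dot m1 m1 + dot m2 m2).
Proof.
move=> h0 hf sd0 hp; pose g k := sin (f k) * cos (f k).
pose A := (1 - cos delta) * (dot m1 m1 + dot m2 m2).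
pose B := (cos delta - 1) * (dot m1 m1 - dot m2 m2).
have term k : sin delta * dot (arc m1 m2 (f k.+1) - arc m1 m2 (f k))
      (arc m1 m2 (f k.+1) - arc m1 m2 (f k)) = sin delta * A + B * (g k.+1 - g k).
  have -> : arc m1 m2 (f k.+1) - arc m1 m2 (f k) =
      (cos (f k.+1) - cos (f k)) *: m1 + (sin (f k.+1) - sin (f k)) *: m2.
    by apply/rowP => i; rewrite !mxE; ring.
  rewrite dot_combl !dot_combr (dotC m2 m1) h0 /A /B /g hf cosD sinD.
  have := cos2Dsin2 (f k); have := cos2Dsin2 delta.
  set C := cos delta; set S := sin delta; set c := cos (f k); set s := sin (f k).
  move=> hd hk; have eS : S ^+ 2 = 1 - C ^+ 2 by rewrite -hd; ring.
  have es : s ^+ 2 = 1 - c ^+ 2 by rewrite -hk; ring.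
  ring: eS es.
apply: (mulfI sd0); rewrite mulr_sumr (eq_bigr _ (fun (k : 'I_p) _ => term k)) big_split /=.
rewrite sumr_const card_ord -mulr_sumr -(big_mkord xpredT (fun k => g k.+1 - g k)).
rewrite telescope_sumr // {1}/g hp sinD2pin cosD2pin subrr mulr0 addr0 /A.
by rewrite -mulr_natl; ring.
Qed.

(** * The angular steps of a star polygon *)

Lemma cos_eq_turn (R : realType) (x y : R) :
  0 < x < 2 * pi -> 0 < y < 2 * pi -> cos x = cos y -> x = y \/ x + y = 2 * pi.
Proof.
move=> /andP[x0 x2] /andP[y0 y2] hxy; have pi0 := pi_gt0 R.
have hinj (u v : R) : 0 <= u <= pi -> 0 <= v <= pi -> cos u = cos v -> u = v.
  by move=> hu hv; apply: cos_inj; rewrite in_itv.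
have cosr (u : R) : cos (2 * pi - u) = cos u.
  by rewrite -[RHS]cosN -[RHS]cosD2pi; congr cos; ring.
have [hx|hx] := lerP x pi; have [hy|hy] := lerP y pi.
- by left; apply: hinj => //; lra.
- have : x = 2 * pi - y by apply: hinj; rewrite ?cosr //; lra.
  by move=> ->; right; ring.
- have : 2 * pi - x = y by apply: hinj; rewrite ?cosr //; lra.
  by move=> <-; right; ring.
- have : 2 * pi - x = 2 * pi - y by apply: hinj; rewrite ?cosr //; lra.
  by move=> h; left; lra.
Qed.

(** Two consecutive steps are equal or opposite modulo a full turn; in the
    second case the motion would come back to where it was two steps before. *)
Lemma constant_step (R : realType) (f : nat -> R) (c : R) (p q : nat) :
  (0 < p)%N -> (forall n, 0 < f n.+1 - f n < 2 * pi) ->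
  (forall n, cos (f n.+1 - f n) = c) -> (forall n, f n.+2 != f n + 2 * pi) ->
  f p = f 0%N + 2 * pi * q%:R ->
  forall n, f n.+1 = f n + 2 * (q%:R * pi / p%:R).
Proof.
move=> p0 hf hc hback hp.
have step n : f n.+1 - f n = f 1%N - f 0%N.
  elim: n => // n IHn; rewrite -IHn.
  have [//|hsum] := cos_eq_turn (hf n.+1) (hf n) (etrans (hc _) (esym (hc _))).
  by case/eqP: (hback n); rewrite -hsum; ring.
have lin n : f n = f 0%N + (f 1%N - f 0%N) * n%:R.
  elim: n => [|n IHn]; first by rewrite mulr0 addr0.
  by rewrite -[LHS](subrK (f n)) step {1}IHn -[n.+1]addn1 natrD; ring.
have p0' : p%:R != 0 :> R by rewrite pnatr_eq0 -lt0n.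
have hd : f 1%N - f 0%N = 2 * (q%:R * pi / p%:R).
  apply: (mulIf p0'); move: hp; rewrite lin => /addrI ->.
  by field.
by move=> n; rewrite -hd -(step n); ring.
Qed.

(** The vertex number n of a star polygon {p/q} is the point q n mod p of the
    cyclic listing; counting the completed turns q n / p makes its angle
    increase with n. *)
Definition lift_angle (R : realType) (p q : nat) (p0 : (0 < p)%N)
    (theta : 'I_p -> R) (n : nat) : R :=
  theta (Ordinal (ltn_pmod (q * n) p0)) + 2 * pi * (q * n %/ p)%:R.

(** One step adds q to the position in the listing, and either stays below p,
    or passes p once and starts a new turn; in both cases the listing covers
    less than one turn between the two positions. *)
Lemma lift_angle_step (R : realType) (p q : nat) (p0 : (0 < p)%N)
    (theta : 'I_p -> R) (n : nat) : (0 < q < p)%N ->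
  (forall i j : 'I_p, (i < j)%N -> theta i < theta j < theta i + 2 * pi) ->
  0 < lift_angle q p0 theta n.+1 - lift_angle q p0 theta n < 2 * pi.
Proof.
move=> /andP[q0 qp] hinc; rewrite /lift_angle.
set i := Ordinal (ltn_pmod (q * n) p0); set j := Ordinal _.
have er : (q * n.+1 = (q * n %/ p) * p + (i + q))%N.
  by rewrite addnA -divn_eq mulnS addnC.
have ip : (i < p)%N := ltn_ord i.
have [hlt|hge] := ltnP (i + q)%N p.
  have ej : j = (i + q)%N :> nat by rewrite /j /= er modnMDl modn_small.
  have ed : (q * n.+1 %/ p = q * n %/ p)%N by rewrite er divnMDl // (divn_small hlt) addn0.
  have /hinc : (i < j)%N by rewrite ej -[X in (X < _)%N]addn0 ltn_add2l.
  by rewrite ed => h; lra.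
have rp : (i + q - p < i)%N by rewrite ltn_subLR // addnC ltn_add2r.
have ej : j = (i + q - p)%N :> nat.
  by rewrite /j /= er modnMDl -(subnK hge) modnDr modn_small ?addnK // (ltn_trans rp).
have ed : (q * n.+1 %/ p = (q * n %/ p) + 1)%N.
  rewrite er divnMDl // -{1}(subnK hge) divnDr // divnn p0.
  by rewrite [X in (_ + (X + _))%N]divn_small // (ltn_trans rp).
have /hinc : (j < i)%N by rewrite ej.
by rewrite ed natrD => h; lra.
Qed.

Lemma lift_angle_turns (R : realType) (p q : nat) (p0 : (0 < p)%N)
    (theta : 'I_p -> R) :
  lift_angle q p0 theta p = lift_angle q p0 theta 0 + 2 * pi * q%:R.
Proof.
rewrite /lift_angle mulnK // muln0 div0n mulr0 addr0; congr (theta _ + _).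
by apply/val_inj; rewrite /= modnMl mod0n.
Qed.

(** * Polygons between homothetic ellipses *)

(** A listing in the negative direction becomes one in the positive direction
    when the second axis is reversed, so both directions are covered by a
    choice of the vector m2. *)
Lemma increasing_listing (R : realType) (p : nat) (E : ellipse R)
    (V : 'I_p -> 'rV[R]_2) :
  cyclically_listed E V ->
  exists m1 m2 (theta : 'I_p -> R),
    [/\ dot m1 m2 = 0, forall t, locus E (Defs.center E + arc m1 m2 t),
        forall j, V j = Defs.center E + arc m1 m2 (theta j) &
        forall i j : 'I_p, (i < j)%N -> theta i < theta j < theta i + 2 * pi].
Proof.
move=> [theta [hV horder]].
pose m1 := semiaxis1 E *: axis1 E; pose m2 := semiaxis2 E *: axis2 E.
have pointE t : ellipse_point E t = Defs.center E + arc m1 m2 t.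
  by rewrite /ellipse_point /arc -addrA !scalerA !(mulrC (cos _)) !(mulrC (sin _)).
have arcN t : arc m1 m2 (- t) = arc m1 (- m2) t.
  by rewrite /arc cosN sinN scaleNr scalerN.
have ort : dot m1 m2 = 0.
  rewrite -[m1]addr0 -(scale0r 0) dot_combl -[m2]addr0 -(scale0r 0) !dot_combr.
  by rewrite axes_orthogonal; ring.
case: horder => hord.
  exists m1, m2, theta; split=> // [t|j]; last by rewrite hV pointE.
  by rewrite -pointE; exists t.
exists m1, (- m2), (fun j => - theta j); split.
- by rewrite dotC -[- m2]add0r dotBl !(dotC _ m1) ort subr0 dotE !mxE; ring.
- by move=> t; rewrite -arcN -pointE; exists (- t).
- by move=> j; rewrite -arcN opprK hV pointE.
- by move=> i j /hord h; lra.
Qed.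

(** With k the ratio of the homothety, m is k ^+ 2: the sign of k is lost, as it
    should be for curves symmetric about O. *)
Lemma homothetic_polar (R : realType) (O : 'rV[R]_2) (E F : ellipse R) :
  homothetic O E F -> exists2 m : R, m != 0 &
    forall x, locus F (O + x) -> polar E x x = m.
Proof.
move=> [hcE _ [k k0 hF]]; exists (k ^+ 2); first by rewrite expf_neq0.
move=> x; rewrite hF => -[X hX]; rewrite /homothety => /addrI <-.
have : locus E (Defs.center E + (X - O)) by rewrite hcE addrC subrK.
move=> /locusP h; rewrite -[k *: _]addr0 -(scale0r 0) polar_combl !polar_combr h.
by ring.
Qed.

Theorem corollary3 (R : realType) (p q : nat) (hp3 : (3 <= p)%N) (hpodd : odd p)
    (A : 'I_p -> 'rV[R]_2) (hA : polygon A)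
    (O : 'rV[R]_2) (Eout Ein : ellipse R) (hE : homothetic O Ein Eout)
    (hins : inscribed A Eout) (hcirc : circumscribed A Ein)
    (hdens : has_density q Eout A)
    (alpha beta : R) (halpha : alpha = semiaxis1 Ein)
    (hbeta : beta = semiaxis2 Ein) :
  \sum_(k < p) euclid_dist (A k) (A (ordS k)) ^+ 2 =
    2 * p%:R * (alpha ^+ 2 + beta ^+ 2) * tan (q%:R * pi / p%:R) ^+ 2.
Proof.
have p0 : (0 < p)%N by apply: leq_trans hp3.
have [_ /andP[q0 qhalf] [V [hlist hAV]]] := hdens.
(* As p is odd, q <= p./2 is strict after doubling; this gives 2 x < pi below. *)
have q2p : (q.*2 < p)%N.
  by rewrite -(odd_double_half p) hpodd ltnS leq_double.
have [m1 [m2 [theta [ort hloc hV hinc]]]] := increasing_listing hlist.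
have [m m0 hm] := homothetic_polar hE.
have [hcin hcout _] := hE.
have [h1 h2 h0] : [/\ polar Ein m1 m1 = m, polar Ein m2 m2 = m & polar Ein m1 m2 = 0].
  by apply: polar_conjugate => t; apply: hm; rewrite -hcout.
pose f := lift_angle q p0 theta; pose X n := arc m1 m2 (f n).
pose P n := A (Ordinal (ltn_pmod n p0)).
have PE n : P n = O + X n.
  rewrite /P (hAV (Ordinal (ltn_pmod (q * n) p0))) ?hV ?hcout /X ?arcD2pin //.
  by rewrite /= modn_mod modnMmr.
have PS n : A (ordS (Ordinal (ltn_pmod n p0))) = P n.+1.
  by congr A; apply/val_inj; rewrite /= -addn1 modnDml addn1.
have Pneq n d : (0 < d < p)%N -> P (n + d)%N <> P n.
  move=> /andP[d0 dp] /hA /(congr1 val) /= /eqP.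
  by rewrite -[X in _ == (X %% _)%N]addn0 eqn_modDl mod0n modn_small // => /eqP d00;
    rewrite d00 in d0.
have hstep n : 0 < f n.+1 - f n < 2 * pi.
  apply: lift_angle_step => //; rewrite q0 /= (leq_ltn_trans _ q2p) //.
  by rewrite -addnn leq_addr.
have hcos n : cos (f n.+1 - f n) = 2 / m - 1.
  have : m + polar Ein (X n) (X n.+1) = 2.
    apply: tangent_polar; rewrite ?(polar_arc _ _ h1 h2 h0) ?subrr ?cos0 ?mulr1 //.
      apply/eqP => e; apply: (Pneq n 1%N); first exact: leq_trans hp3.
      by rewrite addn1 !PE e.
    by rewrite hcin -!PE -PS; apply: hcirc.
  rewrite (polar_arc _ _ h1 h2 h0) => hmc; apply: (mulfI m0).
  by rewrite mulrBr mulrCA divff // -hmc; ring.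
have hback n : f n.+2 != f n + 2 * pi.
  apply/eqP => e; apply: (Pneq n 2%N) => //.
  by rewrite addn2 !PE /X e -[2 * pi]mulr1 (arcD2pin _ _ _ 1).
have hf := constant_step p0 hstep hcos hback (lift_angle_turns q p0 theta).
set x := q%:R * pi / p%:R in hf *.
have p0' : 0 < p%:R :> R by rewrite ltr0n.
have x0 : 0 < x by rewrite divr_gt0 // mulr_gt0 ?pi_gt0 // ltr0n.
have xpi : 2 * x < pi.
  rewrite /x mulrA ltr_pdivrMr // mulrA mulrC ltr_pM2l ?pi_gt0 //.
  by rewrite -natrM ltr_nat mul2n.
have sin0 : sin (2 * x) != 0 by rewrite gt_eqF // sin_gt0_pi // xpi mulr_gt0.
have := sum_chords ort hf sin0 (lift_angle_turns q p0 theta).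
rewrite (conjugate_semidiameters m0 h1 h2 h0) -halpha -hbeta => hsum.
have cosx : m * cos x ^+ 2 = 1.
  have := hcos 0%N; rewrite hf addrAC subrr add0r mulrC mulr_natr cos_mulr2n => hc.
  have : m * (cos x ^+ 2 *+ 2) = 2.
    by rewrite -[X in m * X](subrK 1) hc subrK mulrCA divff ?mulr1.
  by rewrite mulrnAr => hmc; lra.
transitivity (\sum_(k < p) dot (X k.+1 - X k) (X k.+1 - X k)).
  apply: eq_bigr => k _; have -> : k = Ordinal (ltn_pmod k p0).
    by apply/val_inj; rewrite /= modn_small.
  rewrite PS -/(P k) /euclid_dist !PE /= modn_small // sqr_sqrtr.
    by congr dot; rewrite opprD addrACA subrr add0r.
  by rewrite dotE -!expr2 addr_ge0 ?sqr_ge0.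
rewrite hsum /tan.
have c0 : cos x != 0.
  by apply/eqP => c0; move: cosx; rewrite c0 expr0n mulr0 => /esym /eqP; rewrite oner_eq0.
have -> : cos (2 * x) = 1 - 2 * sin x ^+ 2.
  by rewrite mulrC mulr_natr cos_mulr2n sin2cos2; ring.
have -> : m = cos x ^- 2 by apply: (mulIf (expf_neq0 2 c0)); rewrite cosx mulVf ?expf_neq0.
by field.
Qed.
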